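(* Let $\gamma_1$ and $\gamma_2$ be two periodic broken rays in the Euclidean unit disc. Suppose that the rays are basic and not rotations of each other. Then their lengths are different. In fact, the ratio of their lengths is rational if and only if (up to interchanging $\gamma_1$ and $\gamma_2$) $\gamma_1$ is a hexagon (length $6$) and $\gamma_2$ is a diameter (length $4$, counted back and forth).
   Context: In the closed Euclidean unit disc (no interfaces), a broken ray (billiard trajectory) is a polygonal path of straight chords reflecting at the unit circle with equal angles of incidence and reflection. Each periodic broken ray consists of chords with a common opening angle $\alpha\in(0,\pi]$ as seen from the origin, and periodicity means $\alpha=2\pi p/q$ with $p/q\in(0,\frac12]\cap\mathbb Q$ in lowest terms. Rays are considered up to orientation, and the length of a periodic broken ray is the length of its primitive period, i.e. $q$ times the chord length $2\sin(\alpha/2)$. ''Hexagon'' means the inscribed regular hexagon ($p/q=1/6$) and ''diameter'' means the back-and-forth path along a diameter ($p/q=1/2$). In the disc with a single layer, every periodic broken ray is basic: all its legs are chords reflecting from the single boundary circle, or it is a radial ray (a diameter). *)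

(* Defs.v *)
From HB Require Import structures.
From mathcomp Require Import all_boot all_order all_algebra.
From mathcomp Require Import all_classical all_reals all_analysis.

Set Implicit Arguments.
Unset Strict Implicit.
Unset Printing Implicit Defensive.

Import Order.TTheory GRing.Theory Num.Theory.
Local Open Scope ring_scope.
Local Open Scope classical_set_scope.

(* The norm that MathComp-Analysis puts on 'rV[R]_2 is the sup norm, hence the
   explicit Euclidean structure. *)
Definition dot (R : realType) (u v : 'rV[R]_2) : R :=
  \sum_(j < 2) u 0 j * v 0 j.

Definition enorm (R : realType) (u : 'rV[R]_2) : R := Num.sqrt (dot u u).

Definition direction (R : realType) (u : 'rV[R]_2) : 'rV[R]_2 :=
  (enorm u)^-1 *: u.

Definition rotate (R : realType) (t : R) (u : 'rV[R]_2) : 'rV[R]_2 :=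
  \row_(j < 2) if j == 0 then cos t * u 0 0 - sin t * u 0 1
               else sin t * u 0 0 + cos t * u 0 1.

Definition circle_point (R : realType) (t : R) : 'rV[R]_2 :=
  \row_(j < 2) if j == 0 then cos t else sin t.

Definition on_unit_circle (R : realType) (u : 'rV[R]_2) : Prop := enorm u = 1.

(* A polygonal path is given by the bi-infinite sequence of its vertices; its
   k-th leg is the segment from x k to x (k + 1). *)
Definition polygonal_path (R : realType) := int -> 'rV[R]_2.

Definition leg (R : realType) (x : polygonal_path R) (k : int) : 'rV[R]_2 :=
  x (k + 1) - x k.

(* Equal angles of incidence and reflection: the outgoing direction is the
   mirror image of the incoming one in the tangent line to the unit circle at
   the vertex; the unit normal there is the vertex itself. *)
Definition reflects_at (R : realType) (x : polygonal_path R) (k : int) : Prop :=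
  let d := direction (leg x (k - 1)) in
  direction (leg x k) = d - (2 * dot d (x k)) *: x k.

Definition broken_ray (R : realType) (x : polygonal_path R) : Prop :=
  forall k : int,
    [/\ on_unit_circle (x k), x (k + 1) <> x k & reflects_at x k].

Definition is_period (R : realType) (x : polygonal_path R) (n : nat) : Prop :=
  (0 < n)%N /\ forall k : int, x (k + n%:Z) = x k.

Definition periodic_broken_ray (R : realType) (x : polygonal_path R) : Prop :=
  broken_ray x /\ exists n : nat, is_period x n.

Definition is_primitive_period (R : realType) (x : polygonal_path R) (n : nat)
  : Prop :=
  is_period x n /\ forall m : nat, is_period x m -> (n <= m)%N.

(* The junk value 0 is taken only when x is not periodic. *)
Definition primitive_period (R : realType) (x : polygonal_path R) : nat :=
  xget 0%N [set n : nat | is_primitive_period x n].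

Definition ray_length (R : realType) (x : polygonal_path R) : R :=
  \sum_(k < primitive_period x) enorm (leg x k%:Z).

(* The vertex sequence of a path depends on a choice of starting vertex and of
   orientation, neither of which belongs to the ray. *)
Definition same_ray (R : realType) (x y : polygonal_path R) : Prop :=
  exists m : int,
    (forall k : int, y k = x (m + k)) \/ (forall k : int, y k = x (m - k)).

Definition rotations_of_each_other (R : realType) (x y : polygonal_path R)
  : Prop :=
  exists t : R, same_ray (fun k => rotate t (x k)) y.

(* The path through the point at angle t whose chords all have opening angle
   2 * pi * p / q as seen from the origin. *)
Definition regular_ray (R : realType) (p q : nat) (t : R) : polygonal_path R :=
  fun k => circle_point (t + k%:~R * (2 * pi * p%:R / q%:R)).

Definition hexagon (R : realType) (x : polygonal_path R) : Prop :=
  exists t : R, same_ray (regular_ray 1 6 t) x.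

Definition diameter (R : realType) (x : polygonal_path R) : Prop :=
  exists t : R, same_ray (regular_ray 1 2 t) x.

(* With a single boundary circle: either every leg is a chord of that circle
   and the path reflects from it at every vertex, or the ray is radial. *)
Definition basic (R : realType) (x : polygonal_path R) : Prop :=
  (forall k : int, [/\ on_unit_circle (x k), on_unit_circle (x (k + 1))
                     & reflects_at x k])
  \/ diameter x.

(* In the disc without interfaces every broken ray is basic. *)
Lemma broken_ray_basic (R : realType) (x : polygonal_path R) :
  broken_ray x -> basic x.
Proof.
by move=> bx; left=> k; have [? _ ?] := bx k; have [? _ _] := bx (k + 1).
Qed.

(* Main.v *)
Require Import Defs.
From mathcomp Require Import all_boot all_order all_algebra all_field.
From mathcomp Require Import all_classical all_reals all_analysis.
From mathcomp.real_closed Require Import complex.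
From mathcomp Require Import ring lra zify.

Set Implicit Arguments.
Unset Strict Implicit.
Unset Printing Implicit Defensive.

Import Order.TTheory GRing.Theory Num.Theory.
Local Open Scope ring_scope.

(** Geometry turns the theorem into a question about cosines of rational angles.
    On the unit circle the reflection law is equivalent to the recurrence
    x (k + 1) = 2 <x k, x (k - 1)> x k - x (k - 1), whose coefficient does not
    depend on k, so the vertices advance by a constant angle
    ([broken_ray_winding]).  Periodicity makes this angle, up to orientation,
    2 pi p / q with p / q in lowest terms and 0 < p / q <= 1/2; the primitive
    period is then q and the length is q sqrt (2 (1 - cos (2 pi p / q))), and p
    and q determine the ray up to rotation.  If two lengths have a rational
    ratio, then, with v(p, q) = 1 - cos (2 pi p / q), we get a relation
    v(p1, q1) = s v(p2, q2) where s is the square of a rational number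
    ([rational_length_ratio]).

    Such relations are classified by Galois theory ([commensurable_turns]).
    Since cyclotomic polynomials are irreducible, the relation persists when p1
    and p2 are multiplied by any k coprime to q1 q2 ([turn_ratio_conj]).  A
    unit k that is 1 modulo q2 fixes v(p2, q2), hence v(p1, q1), hence is 1 or
    -1 modulo q1.  Testing this on units that move only one prime component
    forces q1 to divide 2 q2, unless q1 is one of 1, 2, 3, 4, 6
    ([dvdn_double_transfer]).  By symmetry, outside these exceptional
    denominators (those with a rational cosine) only three cases are left.
    - q1 = q2: comparing the least conjugates of the two sides gives s = 1,
      so that p1 = p2.
    - q1 = 2 q2, or the converse: comparing the least conjugates gives, for
      c = cos (pi / q2), 1 - c = s (1 - (2 c ^ 2 - 1)), so
      c = 1 / (2 s) - 1 is rational and q1 is exceptional after all.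
    For exceptional denominators v takes the values 2, 3/2, 1, 1/2 at
    q = 2, 3, 4, 6, and the only quotient of two different values that is a
    rational square is 2 / (1/2) = 4: the diameter against the hexagon. *)

(** * Galois conjugation of rational relations between roots of unity *)

(** Over any field of characteristic 0, a primitive N-th root of unity is a root
    of X^N - 1, the product of the cyclotomic polynomials of the divisors
    of N, and a factor of index d < N would give it an order dividing d. *)
Lemma root_Cyclotomic (F : numFieldType) (N : nat) (z : F) :
  N.-primitive_root z -> root (map_poly intr 'Phi_N) z.
Proof.
move=> zN; have N_gt0 := prim_order_gt0 zN.
have : root (map_poly intr ('X^N - 1 : {poly int})) z.
  rewrite rmorphB /= map_polyXn rmorph1 rootE !hornerE.
  by rewrite (prim_expr_order zN) subrr.
rewrite -prod_Cyclotomic // rmorph_prod /= rootE horner_prod prodf_seq_eq0.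
case/hasP=> d; rewrite -dvdn_divisors // => dN /= rd.
have d_gt0 : (0 < d)%N by exact: dvdn_gt0 dN.
have : root (map_poly intr ('X^d - 1 : {poly int})) z.
  rewrite -prod_Cyclotomic // rmorph_prod /= rootE horner_prod prodf_seq_eq0.
  by apply/hasP; exists d => //; rewrite -dvdn_divisors.
rewrite rmorphB /= map_polyXn rmorph1 rootE !hornerE subr_eq0.
rewrite -(prim_order_dvd zN) => Nd.
by have -> : N = d by apply/eqP; rewrite eqn_dvd Nd dN.
Qed.

(** The N-th cyclotomic polynomial is irreducible over the rationals, because it
    is the minimal polynomial of an algebraic complex number.  So it divides
    every rational polynomial that vanishes at one primitive N-th root of unity,
    in whatever field, and that polynomial vanishes at all of them. *)
Lemma root_conj (F : numFieldType) (N k : nat) (z : F) (P : {poly rat}) :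
  N.-primitive_root z -> coprime k N ->
  root (map_poly ratr P) z -> root (map_poly ratr P) (z ^+ k).
Proof.
move=> zN kN Pz; have N_gt0 := prim_order_gt0 zN.
pose Phi : {poly rat} := map_poly intr 'Phi_N.
have PhiE (L : numFieldType) :
    map_poly (ratr : rat -> L) Phi = map_poly intr 'Phi_N.
  by rewrite -map_poly_comp; apply: eq_map_poly => i /=; rewrite ratr_int.
have [w wN] := C_prim_root_exists N_gt0.
have [p [Dp _ dvp]] := minCpolyP w.
have pE : p = Phi.
  apply: (map_poly_inj (ratr : {rmorphism rat -> algC})).
  by rewrite -Dp (minCpoly_cyclotomic wN) PhiE (Cintr_Cyclotomic wN).
have Phi0 : Phi != 0.
  by rewrite -(map_poly_eq0 (ratr : {rmorphism rat -> algC})) PhiE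
     (Cintr_Cyclotomic wN) monic_neq0 ?cyclotomic_monic.
have zPhi : root (map_poly (ratr : rat -> F) Phi) z.
  by rewrite PhiE root_Cyclotomic.
pose g := gcdp P Phi.
have zg : root (map_poly (ratr : rat -> F) g) z.
  by rewrite gcdp_map root_gcd Pz.
have PhiP : Phi %| P.
  have /dvdpP[h hE] : g %| Phi by exact: dvdp_gcdr.
  have : root (map_poly (ratr : rat -> algC) Phi) w by rewrite dvp pE.
  (* If w is a root of h, then Phi divides h, and g is constant. *)
  rewrite {1}hE rmorphM rootM !dvp pE => /orP[Ph|Pg]; last first.
    by apply: dvdp_trans Pg _; exact: dvdp_gcdl.
  have g0 : g != 0 by apply: contraNneq Phi0 => g0; rewrite hE g0 mulr0.
  have h0 : h != 0 by apply: contraNneq Phi0 => h0; rewrite hE h0 mul0r.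
  have := dvdp_leq h0 Ph; rewrite hE size_mul // => sh.
  have sg : size g == 1.
    move: g0 h0 sh; rewrite -!size_poly_gt0.
    by move: (size g) (size h) => a b; lia.
  case/size_poly1P: sg => c c0 gE.
  by move: zg; rewrite gE map_polyC /= rootC fmorph_eq0 (negbTE c0).
have zkPhi : root (map_poly (ratr : rat -> F) Phi) (z ^+ k).
  by rewrite PhiE (@root_Cyclotomic _ N) // prim_root_exp_coprime.
case/dvdpP: PhiP => h ->; rewrite rmorphM rootM; apply/orP; right.
exact: zkPhi.
Qed.

(** * Cosines of rational angles *)

Definition cos_turn (R : realType) (q a : nat) : R :=
  cos (2 * pi * a%:R / q%:R).

Lemma cos_turn0 (R : realType) (q : nat) : cos_turn R q 0 = 1.
Proof. by rewrite /cos_turn mulr0 mul0r cos0. Qed.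

Lemma cos_sinD2pi (R : realType) (x : R) (n : nat) :
  (cos (x + 2 * pi * n%:R) = cos x) * (sin (x + 2 * pi * n%:R) = sin x).
Proof.
elim: n => [|n [IHc IHs]]; first by rewrite mulr0 addr0.
have -> : x + 2 * pi * n.+1%:R = x + 2 * pi * n%:R + pi *+ 2 :> R.
  by rewrite -natr1 -mulr_natl; ring.
by rewrite cosD2pi sinD2pi.
Qed.

Lemma cos_turnMr (R : realType) (q a m : nat) :
  (0 < m)%N -> cos_turn R (q * m) (a * m) = cos_turn R q a.
Proof.
move=> m0; have [->|q0] := posnP q;
  first by rewrite /cos_turn mul0n !invr0 !mulr0.
rewrite /cos_turn !natrM; congr cos; field.
by rewrite !pnatr_eq0 -!lt0n m0 q0.
Qed.

Lemma cos_turn_mod (R : realType) (q a b : nat) :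
  (0 < q)%N -> a = b %[mod q] -> cos_turn R q a = cos_turn R q b.
Proof.
move=> q0 ab.
suff H c : cos_turn R q c = cos_turn R q (c %% q) by rewrite H ab -H.
rewrite /cos_turn {1}(divn_eq c q) natrD natrM.
have -> : 2 * pi * ((c %/ q)%:R * q%:R + (c %% q)%:R) / q%:R =
   2 * pi * (c %% q)%:R / q%:R + 2 * pi * (c %/ q)%:R :> R.
  by field; rewrite pnatr_eq0 -lt0n.
by rewrite cos_sinD2pi.
Qed.

Lemma cos_turn_sub (R : realType) (q a : nat) :
  (0 < q)%N -> (a <= q)%N -> cos_turn R q (q - a) = cos_turn R q a.
Proof.
move=> q0 aq; rewrite /cos_turn natrB //.
have -> : 2 * pi * (q%:R - a%:R) / q%:R =
   - (2 * pi * a%:R / q%:R) + 2 * pi * 1%:R :> R.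
  by field; rewrite pnatr_eq0 -lt0n.
by rewrite cos_sinD2pi cosN.
Qed.

Lemma cos_turn_half_lt (R : realType) (q a b : nat) :
  (a.*2 <= q)%N -> (b.*2 <= q)%N ->
  (cos_turn R q a < cos_turn R q b) = (b < a)%N.
Proof.
have [->|q0] := posnP q.
  by rewrite !leqn0 !double_eq0 => /eqP-> /eqP->; rewrite ltxx.
have qR : 0 < q%:R :> R by rewrite ltr0n.
have itv c : (c.*2 <= q)%N -> 2 * pi * c%:R / q%:R \in `[0, pi :> R].
  move=> cq; rewrite in_itv /=; apply/andP; split.
    by rewrite !mulr_ge0 ?invr_ge0 ?pi_ge0 ?ler0n.
  rewrite ler_pdivrMr // mulrAC mulrC ler_wpM2l ?pi_ge0 //.
  by rewrite -natrM ler_nat mul2n.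
move=> aq bq; rewrite /cos_turn ltr_cos ?itv // ltr_pM2r ?invr_gt0 //.
by rewrite ltr_pM2l ?mulr_gt0 ?pi_gt0 // ltr_nat.
Qed.

(** The angle 2 pi a / q folded into the interval from 0 to pi, where the cosine
    is injective and decreasing. *)
Definition fold_turn (q a : nat) : nat := minn (a %% q) (q - a %% q).

Lemma cos_turn_fold (R : realType) (q a : nat) :
  (0 < q)%N -> cos_turn R q (fold_turn q a) = cos_turn R q a.
Proof.
move=> q0; rewrite -(@cos_turn_mod R q (a %% q) a) ?modn_mod // /fold_turn.
rewrite /minn; case: ifP => // _; rewrite cos_turn_sub //.
by rewrite ltnW ?ltn_pmod.
Qed.

Lemma fold_turn_le (q a : nat) : ((fold_turn q a).*2 <= q)%N.
Proof.
have [->|q0] := posnP q; first by rewrite /fold_turn sub0n minn0.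
by have := ltn_pmod a q0; rewrite /fold_turn; move: (a %% q)%N => c; lia.
Qed.

Lemma cos_turn_eq (R : realType) (q a b : nat) :
  (0 < q)%N -> cos_turn R q a = cos_turn R q b ->
  a = b %[mod q] \/ (q %| a + b)%N.
Proof.
move=> q0; rewrite -(cos_turn_fold R a q0) -(cos_turn_fold R b q0) => e.
have {e} : fold_turn q a = fold_turn q b.
  have := cos_turn_half_lt R (fold_turn_le q a) (fold_turn_le q b).
  have := cos_turn_half_lt R (fold_turn_le q b) (fold_turn_le q a).
  by rewrite e ltxx; move: (fold_turn q a) (fold_turn q b) => ? ?; lia.
rewrite /dvdn -(modnDm a b) /fold_turn.
have := ltn_pmod a q0; have := ltn_pmod b q0.
move: (a %% q)%N (b %% q)%N => c d dq cq e.
have [->|{}e] : c = d \/ (c + d = q)%N by lia.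
  by left.
by right; rewrite e modnn.
Qed.

Lemma cos_turn_le1 (R : realType) (q a : nat) :
  (0 < q)%N -> ~~ (q %| a)%N -> cos_turn R q a <= cos_turn R q 1.
Proof.
move=> q0 qa; have q2 : (1.*2 <= q)%N.
  by case: q q0 qa => [|[|q]] //; rewrite dvd1n.
rewrite -(cos_turn_fold R a q0) leNgt cos_turn_half_lt ?fold_turn_le //.
move: qa; rewrite /dvdn /fold_turn; have := ltn_pmod a q0.
by move: (a %% q)%N => c; lia.
Qed.

Lemma cos_turn_lt1 (R : realType) (q a : nat) :
  (0 < q)%N -> ~~ (q %| a)%N -> cos_turn R q a < 1.
Proof.
move=> q0 qa; apply: le_lt_trans (cos_turn_le1 R q0 qa) _.
have q2 : (1.*2 <= q)%N.
  by case: q q0 qa => [|[|q]] //; rewrite dvd1n.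
by rewrite -(cos_turn0 R q) cos_turn_half_lt.
Qed.

Lemma cos_turn_eq1 (R : realType) (q a : nat) :
  (0 < q)%N -> cos_turn R q a = 1 -> (q %| a)%N.
Proof.
by move=> q0 e; apply/negPn/negP => /(cos_turn_lt1 R q0); rewrite e ltxx.
Qed.

(** exp (2 i pi / N), as an element of R[i]. *)
Definition turn_root (R : realType) (N : nat) : R[i] :=
  (cos (2 * pi / N%:R) +i* sin (2 * pi / N%:R))%C.

Lemma turn_rootX (R : realType) (N k : nat) :
  turn_root R N ^+ k =
  (cos_turn R N k +i* sin (2 * pi * k%:R / N%:R))%C.
Proof.
rewrite /cos_turn; elim: k => [|k IH]; first by rewrite mulr0 mul0r cos0 sin0.
rewrite exprS IH /turn_root.
have -> : 2 * pi * k.+1%:R / N%:R = 2 * pi / N%:R + 2 * pi * k%:R / N%:R :> R.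
  by rewrite -natr1; ring.
rewrite cosD sinD; apply/eqP; rewrite eq_complex /=; apply/andP.
by split; apply/eqP; ring.
Qed.

Lemma turn_root_prim (R : realType) (N : nat) :
  (0 < N)%N -> N.-primitive_root (turn_root R N).
Proof.
move=> N0; have wN : turn_root R N ^+ N = 1.
  rewrite turn_rootX /cos_turn.
  have -> : 2 * pi * N%:R / N%:R = 0 + 2 * pi * 1%:R :> R.
    by field; rewrite pnatr_eq0 -lt0n.
  by rewrite !cos_sinD2pi cos0 sin0.
have [m mw mN] := prim_order_exists N0 wN.
suff Nm : (N %| m)%N.
  have e : m = N by apply/eqP; rewrite eqn_dvd mN.
  by rewrite e in mw.
apply: (@cos_turn_eq1 R) => //.
by have := prim_expr_order mw; rewrite turn_rootX => -[].
Qed.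

Lemma turn_root_addV (R : realType) (N m : nat) : (0 < N)%N ->
  turn_root R N ^+ m + turn_root R N ^+ (m * N.-1) =
  (2 * cos_turn R N m)%:C%C.
Proof.
move=> N0; rewrite !turn_rootX /cos_turn natrM -subn1 natrB //.
have -> : 2 * pi * (m%:R * (N%:R - 1%:R)) / N%:R =
    - (2 * pi * m%:R / N%:R) + 2 * pi * m%:R :> R.
  by field; rewrite pnatr_eq0 -lt0n.
rewrite !cos_sinD2pi cosN sinN; apply/eqP; rewrite eq_complex /=.
by apply/andP; split; apply/eqP; ring.
Qed.

(** By [turn_root_addV], 2 cos (2 pi j / N) is the value of the polynomial
    X^j + X^(j (N - 1)) at exp (2 i pi / N), so a rational relation between such
    cosines is a rational polynomial that vanishes there; its value at
    exp (2 i pi k / N) is the conjugate relation. *)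
Lemma cos_turn_conj (R : realType) (N a b k : nat) (s : rat) :
  (0 < N)%N -> coprime k N ->
  1 - cos_turn R N a = ratr s * (1 - cos_turn R N b) ->
  1 - cos_turn R N (k * a) = ratr s * (1 - cos_turn R N (k * b)).
Proof.
move=> N0 kN e.
pose c j : {poly rat} := 'X^j + 'X^(j * N.-1).
pose P := (2%:P - c a) - s%:P * (2%:P - c b).
have wP k' : (map_poly (ratr : rat -> R[i]) P).[turn_root R N ^+ k'] =
    (2 * ((1 - cos_turn R N (k' * a)) - ratr s * (1 - cos_turn R N (k' * b))))%:C%C.
  set rhs := RHS.
  rewrite /P /c !(rmorphB, rmorphM, rmorphD) /= !map_polyXn !map_polyC /= !hornerE.
  rewrite -!exprM !mulnA !turn_root_addV // -(fmorph_rat (real_complex R) s) !rmorph1.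
  rewrite /rhs; move: (ratr s : R) (cos_turn _ _ _) (cos_turn _ _ _) => t x y.
  by apply/eqP; rewrite eq_complex /=; apply/andP; split; apply/eqP; ring.
have : root (map_poly ratr P) (turn_root R N).
  by rewrite rootE -[turn_root R N]expr1 wP !mul1n e subrr mulr0.
move/(root_conj (turn_root_prim R N0) kN); rewrite rootE wP.
rewrite eq_complex /= eqxx andbT mulf_eq0 pnatr_eq0 /= subr_eq0.
by move/eqP.
Qed.

Lemma turn_ratio_conj (R : realType) (q1 p1 q2 p2 k : nat) (s : rat) :
  (0 < q1)%N -> (0 < q2)%N -> coprime k (q1 * q2) ->
  1 - cos_turn R q1 p1 = ratr s * (1 - cos_turn R q2 p2) ->
  1 - cos_turn R q1 (k * p1) = ratr s * (1 - cos_turn R q2 (k * p2)).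
Proof.
move=> q1_gt0 q2_gt0 kq.
rewrite -!(@cos_turnMr R q1 _ q2) // -!(@cos_turnMr R q2 _ q1) //.
rewrite -!mulnA [(q2 * q1)%N]mulnC => /(cos_turn_conj _ kq).
by apply; rewrite muln_gt0 q1_gt0.
Qed.

(** * Comparing the denominators *)

(** Conjugating by k fixes the right-hand side of the relation, so it also fixes
    cos (2 pi p1 / q1), which determines p1 / q1 modulo 1 up to sign. *)
Lemma unit_congr_transfer (R : realType) (q1 p1 q2 p2 k : nat) (s : rat) :
  (0 < q1)%N -> (0 < q2)%N -> coprime p1 q1 -> coprime k (q1 * q2) ->
  1 - cos_turn R q1 p1 = ratr s * (1 - cos_turn R q2 p2) ->
  k = 1 %[mod q2] -> k = 1 %[mod q1] \/ (q1 %| k.+1)%N.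
Proof.
move=> q1_gt0 q2_gt0 p1q1 kq rel k1.
have := turn_ratio_conj q1_gt0 q2_gt0 kq rel.
rewrite (@cos_turn_mod R q2 (k * p2) p2) //; last by rewrite -modnMml k1 modnMml mul1n.
have [k0|k_gt0] := posnP k.
  move: kq; rewrite k0 /coprime gcd0n muln_eq1 => /andP[/eqP-> _] _.
  by left; rewrite !modn1.
rewrite -rel => /addrI/oppr_inj/(cos_turn_eq q1_gt0)[|].
  move/eqP; rewrite -{2}[p1]mul1n => h; left; apply/eqP.
  move: h; rewrite !eqn_mod_dvd ?leq_mul2r ?k_gt0 ?orbT //.
  by rewrite -mulnBl Gauss_dvdl // coprime_sym.
by rewrite addnC -mulSn Gauss_dvdl // 1?coprime_sym // => ?; right.
Qed.

(** The positive integers q with cos (2 pi / q) rational: the possible orders of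
    a rotation that preserves a plane lattice, as in the crystallographic
    restriction theorem. *)
Definition crystallographic (q : nat) : bool :=
  q \in [:: 1; 2; 3; 4; 6]%N.

(** Suppose that p divides q1 = m p^(e + 1) to a higher power than q2 = n p^f.
    The multiple M = m n p^e of q2 is divisible by every prime power of q1 but
    the one at p.  If e > 0 then M + 1 is a unit that violates
    [unit_congr_transfer]; if e = 0 and p is odd, so is a k that is 1 modulo M and 2 modulo p.  The
    conclusion k = -1 modulo q1 is the only escape, and forces q1 to be
    crystallographic. *)
Lemma logn_transfer (R : realType) (q1 p1 q2 p2 p : nat) (s : rat) :
  (0 < q1)%N -> (0 < q2)%N -> coprime p1 q1 ->
  1 - cos_turn R q1 p1 = ratr s * (1 - cos_turn R q2 p2) ->
  ~~ crystallographic q1 -> prime p -> (logn p q2 < logn p q1)%N ->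
  p = 2%N /\ logn p q1 = 1%N.
Proof.
move=> q1_gt0 q2_gt0 p1q1 rel ncr p_pr.
have [m pm q1E] := pfactor_coprime p_pr q1_gt0.
have [n pn q2E] := pfactor_coprime p_pr q2_gt0.
set e := logn p q1 in q1E *; set f := logn p q2 in q2E *.
case: e q1E => // e q1E; rewrite ltnS => fe.
have transfer := unit_congr_transfer q1_gt0 q2_gt0 p1q1 _ rel.
pose M := (m * n * p ^ e)%N.
have q2M : (q2 %| M)%N by rewrite q2E /M -mulnA dvdn_mull // dvdn_mul // dvdn_exp2l.
have mpe : (m * p ^ e %| M)%N by rewrite /M mulnAC dvdn_mulr.
case: e => [|e] in q1E fe M q2M mpe *.
  have f0 : f = 0%N by lia.
  rewrite muln1 in mpe; rewrite expn1 in q1E.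
  have [pE|p_odd] := even_prime p_pr; first by split.
  have pM : coprime p M by rewrite /M muln1 coprimeMr pm pn.
  (* p is odd, so 2 is a unit modulo p. *)
  pose k := chinese p M 2 1.
  have kp : k = 2 %[mod p] by exact: chinese_modl.
  have kM : k = 1 %[mod M] by exact: chinese_modr.
  have cp2 : coprime 2 p by rewrite coprime2n.
  have ck : coprime k (q1 * q2).
    rewrite q1E q2E f0 expn0 !muln1 -mulnA mulnCA -[(m * n)%N]muln1 coprimeMr.
    by rewrite -coprime_modl kp coprime_modl cp2 -coprime_modl kM coprime_modl coprime1n.
  have k1 : k = 1 %[mod q2].
    by apply/eqP; rewrite -(modn_dvdm _ q2M) kM modn_dvdm.
  exfalso; have [k1q|kq] := transfer _ ck k1.
    have : k = 1 %[mod p].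
      have pq : (p %| q1)%N by rewrite q1E dvdn_mull.
      by rewrite -(modn_dvdm _ pq) k1q modn_dvdm.
    rewrite kp => /eqP; rewrite eqn_mod_dvd // dvdn1 => /eqP pE.
    by rewrite pE in p_pr.
  (* Otherwise k = -1 modulo q1, but k = 2 modulo p and k = 1 modulo m. *)
  have : (p %| 3)%N.
    have : (p %| k.+1)%N by apply: dvdn_trans kq; rewrite q1E dvdn_mull.
    by rewrite /dvdn -addn1 -modnDml kp modnDml.
  rewrite dvdn_prime2 // => /eqP p3.
  have : (m %| 2)%N.
    have mk : (m %| k.+1)%N by apply: dvdn_trans kq; rewrite q1E dvdn_mulr.
    have : k = 1 %[mod m] by rewrite -(modn_dvdm _ mpe) kM modn_dvdm.
    by move: mk; rewrite /dvdn -addn1 => + h; rewrite -modnDml h modnDml.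
  move/(dvdn_leq (isT : 0 < 2)%N) => m2.
  by move: ncr q1_gt0; rewrite q1E p3; clear -m2; case: m m2 => [|[|[|]]].
have pM : (p %| M)%N by rewrite /M expnS mulnCA dvdn_mulr.
have ck : coprime M.+1 (q1 * q2).
  (* q2 divides M and q1 divides M p, hence M ^ 2. *)
  have : coprime M.+1 (M ^ 3) by rewrite coprimeXr // coprimeSn.
  apply: coprime_dvdr; rewrite 2!expnS expn1 mulnA dvdn_mul //.
  by rewrite q1E expnSr mulnA dvdn_mul.
have k1 : M.+1 = 1 %[mod q2] by rewrite -addn1 -modnDml (eqP q2M).
exfalso; have [k1q|kq] := transfer _ ck k1.
  have m_gt0 : (0 < m)%N by move: q1_gt0; rewrite q1E muln_gt0 => /andP[].
  have q1E' : q1 = (m * p ^ e.+1 * p)%N by rewrite q1E [RHS]mulnAC -mulnA -expnS.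
  move/eqP: k1q; rewrite eqn_mod_dvd // subn1 /= q1E' /M [(m * n * _)%N]mulnAC.
  rewrite dvdn_pmul2l; last by rewrite muln_gt0 m_gt0 expn_gt0 prime_gt0.
  by move: pn; rewrite prime_coprime // => /negbTE->.
(* Otherwise q1 divides M + 2, while m p ^ (e + 1) divides M. *)
have : (m * p ^ e.+1 %| 2)%N.
  rewrite -(dvdn_addr _ mpe) addn2; apply: dvdn_trans kq.
  by rewrite q1E [in X in (_ %| X)%N]expnSr mulnA dvdn_mulr.
move=> d2; have : (p %| 2)%N by apply: dvdn_trans d2; rewrite expnS mulnCA dvdn_mulr.
rewrite dvdn_prime2 // => /eqP pE.
have := dvdn_leq (isT : 0 < 2)%N d2.
move: ncr q1_gt0 pm; rewrite q1E pE !expnS;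
  case: m {q1E M q2M mpe pM ck k1 kq d2} => [|[|m]] //.
  case: e {fe} => [|e] // _ _ _; rewrite !expnS; have := expn_gt0 2 e; lia.
move=> _ _ _; have := expn_gt0 2 e; nia.
Qed.

Lemma dvdn_double_transfer (R : realType) (q1 p1 q2 p2 : nat) (s : rat) :
  (0 < q1)%N -> (0 < q2)%N -> coprime p1 q1 ->
  1 - cos_turn R q1 p1 = ratr s * (1 - cos_turn R q2 p2) ->
  ~~ crystallographic q1 ->
  (q1 %| q2.*2)%N.
Proof.
move=> q1_gt0 q2_gt0 p1q1 rel ncr.
have n_gt0 : (0 < q2.*2)%N by rewrite double_gt0.
apply/dvdn_partP => // p; rewrite mem_primes => /and3P[p_pr _ _].
rewrite p_part pfactor_dvdn //.
have [le|lt] := leqP (logn p q1) (logn p q2).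
  by apply: leq_trans le (dvdn_leq_log _ n_gt0 _); rewrite -mul2n dvdn_mull.
have [-> ->] := logn_transfer q1_gt0 q2_gt0 p1q1 rel ncr p_pr lt.
by rewrite logn_gt0 mem_primes n_gt0 dvdn2 odd_double.
Qed.

(** Only the primes of n that do not divide q have to be avoided; k is taken to
    be 1 modulo the corresponding part of n. *)
Lemma unit_lift (q n u : nat) :
  (0 < q)%N -> (0 < n)%N -> coprime u q ->
  exists2 k, k = u %[mod q] & coprime k (q * n).
Proof.
move=> q_gt0 n_gt0 uq; set n' := (n`_(\pi(q)^'))%N.
have qn' : coprime q n' by rewrite coprime_pi' ?part_pnat ?part_gt0.
pose k := chinese q n' u 1.
have kq : k = u %[mod q] by exact: chinese_modl.
have kn' : k = 1 %[mod n'] by exact: chinese_modr.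
exists k => //.
have ckq : coprime k q by rewrite -coprime_modl kq coprime_modl.
rewrite coprimeMr ckq -(partnC (\pi(q)) n_gt0) coprimeMr.
rewrite -[coprime k n']coprime_modl kn' coprime_modl coprime1n andbT.
have [k0|k_gt0] := posnP k.
  move: ckq; rewrite k0 /coprime gcd0n => /eqP->.
  by rewrite gcd0n; apply/eqP/part_p'nat/pnatP.
rewrite coprime_sym; apply: (@pnat_coprime (\pi(q))); first exact: part_pnat.
by rewrite -coprime_pi' // coprime_sym.
Qed.

(** Some conjugation sends p1 to 1 modulo q1.  The right-hand side of the
    conjugate relation is s times a conjugate of 1 - cos (2 pi p2 / q2), and the
    least of these is 1 - cos (2 pi / q2). *)
Lemma min_transfer (R : realType) (q1 p1 q2 p2 : nat) (s : rat) :
  (1 < q1)%N -> (1 < q2)%N -> coprime p1 q1 -> coprime p2 q2 -> 0 <= s ->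
  1 - cos_turn R q1 p1 = ratr s * (1 - cos_turn R q2 p2) ->
  ratr s * (1 - cos_turn R q2 1) <= 1 - cos_turn R q1 1.
Proof.
move=> q1_gt1 q2_gt1 p1q1 p2q2 s_ge0 rel.
have q1_gt0 := ltnW q1_gt1; have q2_gt0 := ltnW q2_gt1.
have [k ku ck] := unit_lift q1_gt0 q2_gt0 (coprimeXl (totient q1).-1 p1q1).
have kp1 : (k * p1)%N = 1 %[mod q1].
  by rewrite -modnMml ku modnMml -expnSr prednK ?totient_gt0 // cyclic.Euler_exp_totient.
have := turn_ratio_conj q1_gt0 q2_gt0 ck rel.
rewrite (cos_turn_mod R q1_gt0 kp1) => ->.
apply: ler_wpM2l; first by rewrite ler0q.
rewrite lerD2l lerN2 cos_turn_le1 //.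
move: ck; rewrite coprimeMr => /andP[_ kq2].
by rewrite mulnC Gauss_dvdl 1?coprime_sym //; apply: contraL p2q2 => h;
   rewrite /coprime (gcdn_idPr h) gtn_eqF.
Qed.

(** * Crystallographic denominators *)

Lemma sqr_rat_nat (r : rat) (n : nat) :
  r ^+ 2 = n%:R -> exists m : nat, n = (m ^ 2)%N.
Proof.
move=> rn; exists `|numq r|%N.
have d0 : (denq r)%:~R != 0 :> rat by rewrite intr_eq0 denq_eq0.
have e : (`|numq r| ^ 2 = n * `|denq r| ^ 2)%N.
  rewrite -!abszX -[n in RHS]/(`|n%:Z|)%N -abszM; congr absz.
  apply/eqP; rewrite -(eqr_int rat) rmorphXn rmorphM rmorphXn /= -pmulrn -rn.
  by rewrite -{2}[r]divq_num_den exprMn exprVn divfK // expf_neq0.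
have : (`|denq r| ^ 2 %| `|numq r| ^ 2)%N by rewrite e dvdn_mull.
rewrite dvdn_pexp2r // => d1.
have := coprime_num_den r; rewrite /coprime (gcdn_idPr d1) => /eqP h.
by rewrite e h muln1.
Qed.

(** The rational value of 1 - cos (2 pi / q) for q = 2, 3, 4, 6; the last branch
    is the value for q = 6. *)
Definition versine (q : nat) : rat :=
  if q == 2 then 2 else if q == 3 then 3 / 2 else if q == 4 then 1
  else 1 / 2.

(** The double angle formula for c = cos (pi / 3) reads 2 c^2 - 1 = - c, because
    2 pi / 3 = pi - pi / 3; its positive solution is 1/2. *)
Lemma versineP (R : realType) (q : nat) :
  (1 < q)%N -> crystallographic q -> 1 - cos_turn R q 1 = ratr (versine q).
Proof.
have c3 : cos (pi / 3) = 1 / 2 :> R.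
  set c : R := cos _.
  have c2 : c ^+ 2 *+ 2 - 1 = - c.
    rewrite -cos_mulr2n /c -[pi / 3 *+ 2]/(pi / 3 + pi / 3).
    have -> : pi / 3 + pi / 3 = - (pi / 3) + pi :> R by field.
    by rewrite cosDpi cosN.
  have c_gt0 : 0 < c.
    apply: cos_gt0_pihalf; have := pi_gt0 R; lra.
  have : (2 * c - 1) * (c + 1) = 0 by move: c2; rewrite -mulr_natr; lra.
  move/eqP; rewrite mulf_eq0 => /orP[/eqP|/eqP]; lra.
have c23 : cos (2 * pi / 3) = - (1 / 2) :> R.
  have -> : 2 * pi / 3 = (pi / 3) *+ 2 :> R by field.
  by rewrite cos_mulr2n c3 -mulr_natr; field.
rewrite /crystallographic !inE => q_gt1.
case/or4P => [/eqP q1|/eqP->|/eqP->|]; first by rewrite q1 in q_gt1.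
- rewrite -[versine 2]/(2%:R) ratr_nat /cos_turn.
  have -> : 2 * pi * 1%:R / 2 = pi :> R by field.
  by rewrite cospi; ring.
- rewrite -[versine 3]/(3%:R / 2%:R) fmorph_div !rmorph_nat /cos_turn mulr1 c23; by field.
case/orP=> /eqP->.
  rewrite -[versine 4]/(1 : rat) rmorph1 /cos_turn.
  have -> : 2 * pi * 1%:R / 4 = pi / 2 :> R by field.
  by rewrite cos_pihalf subr0.
rewrite -[versine 6]/(1 / 2%:R) fmorph_div rmorph1 rmorph_nat /cos_turn.
have -> : 2 * pi * 1%:R / 6 = pi / 3 :> R by field.
by rewrite c3; field.
Qed.

(** A rational value is commensurable with 1 - cos pi = 2, so
    [dvdn_double_transfer] applies with denominator 2 and leaves only divisors
    of 4. *)
Lemma crystallographic_of_rational (R : realType) (q p : nat) (s : rat) :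
  (0 < q)%N -> coprime p q -> 1 - cos_turn R q p = ratr s ->
  crystallographic q.
Proof.
move=> q_gt0 pq e; apply/negPn/negP => ncr.
have : (q %| 2.*2)%N.
  apply: (@dvdn_double_transfer R q p 2 1 (s / 2)) => //.
  rewrite (@versineP R 2) // -[versine 2]/(2%:R) -rmorphM e; congr ratr.
  by rewrite divfK.
move=> q4; have := dvdn_leq (isT : 0 < 2.*2)%N q4; clear -q_gt0 ncr q4.
by case: q q_gt0 ncr q4 => [|[|[|[|[|]]]]].
Qed.

(** The relation can be read in both directions, and [min_transfer] then gives
    both inequalities. *)
Lemma min_transfer_eq (R : realType) (q1 p1 q2 p2 : nat) (s : rat) :
  (1 < q1)%N -> (1 < q2)%N -> coprime p1 q1 -> coprime p2 q2 -> 0 < s ->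
  1 - cos_turn R q1 p1 = ratr s * (1 - cos_turn R q2 p2) ->
  1 - cos_turn R q1 1 = ratr s * (1 - cos_turn R q2 1).
Proof.
move=> q1_gt1 q2_gt1 p1q1 p2q2 s_gt0 rel.
have sR : 0 < ratr s :> R by rewrite ltr0q.
apply/eqP; rewrite eq_le (min_transfer q1_gt1 q2_gt1 p1q1 p2q2 (ltW s_gt0) rel) andbT.
rewrite -ler_pdivrMl //.
have := @min_transfer R q2 p2 q1 p1 s^-1 q2_gt1 q1_gt1 p2q2 p1q1.
rewrite fmorphV rel mulKf ?gt_eqF //; apply=> //.
by rewrite ltW // invr_gt0.
Qed.

Lemma turn_versine_gt0 (R : realType) (q p : nat) :
  (1 < q)%N -> coprime p q -> 0 < 1 - cos_turn R q p.
Proof.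
move=> q_gt1 pq; rewrite subr_gt0 cos_turn_lt1 ?(ltnW q_gt1) //.
by apply: contraL pq => h; rewrite /coprime (gcdn_idPr h) gtn_eqF.
Qed.

Lemma versine_ratio_gt0 (R : realType) (q1 p1 q2 p2 : nat) (s : rat) :
  (1 < q1)%N -> (1 < q2)%N -> coprime p1 q1 -> coprime p2 q2 ->
  1 - cos_turn R q1 p1 = ratr s * (1 - cos_turn R q2 p2) -> 0 < s.
Proof.
move=> q1_gt1 q2_gt1 p1q1 p2q2 rel.
have := turn_versine_gt0 R q1_gt1 p1q1; rewrite rel pmulr_lgt0 ?turn_versine_gt0 //.
by rewrite ltr0q.
Qed.

(** With c = cos (2 pi / 2d), the comparison of the least conjugates and the
    double angle formula give 1 - c = s (2 - 2 c^2); dividing by 1 - c shows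
    that c is rational. *)
Lemma double_turn_crystallographic (R : realType) (d p1 p2 : nat) (s : rat) :
  (1 < d)%N -> coprime p1 d.*2 -> coprime p2 d ->
  1 - cos_turn R d.*2 p1 = ratr s * (1 - cos_turn R d p2) ->
  crystallographic d.*2.
Proof.
move=> d_gt1 p1d p2d rel.
have dd_gt1 : (1 < d.*2)%N by rewrite -addnn ltn_addr.
have s_gt0 := versine_ratio_gt0 dd_gt1 d_gt1 p1d p2d rel.
have := min_transfer_eq dd_gt1 d_gt1 p1d p2d s_gt0 rel.
have -> : cos_turn R d 1 = cos_turn R d.*2 1 ^+ 2 *+ 2 - 1.
  rewrite -cos_mulr2n /cos_turn; congr cos; rewrite -mul2n natrM.
  by field; rewrite pnatr_eq0 -lt0n ltnW.
have c_lt1 := turn_versine_gt0 R dd_gt1 (coprime1n d.*2).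
move=> e; apply: (@crystallographic_of_rational R d.*2 1 (2 - (2 * s)^-1)).
- by rewrite ltnW.
- exact: coprime1n.
move: e c_lt1; set c := cos_turn _ _ _ => e c_lt1.
have sR : 0 < ratr s :> R by rewrite ltr0q.
have {}e : 1 = 2 * ratr s * (1 + c).
  by apply: (mulfI (lt0r_neq0 c_lt1)); rewrite mulr1 {1}e -mulr_natr; ring.
rewrite rmorphB fmorphV rmorphM !rmorph_nat.
have -> : (2 * ratr s)^-1 = 1 + c.
  by apply: (mulfI (_ : 2 * ratr s != 0)); rewrite ?divff -?e // mulf_neq0 ?gt_eqF.
by ring.
Qed.

Lemma crystallographic_turn1 (p q : nat) :
  (0 < p)%N -> (p.*2 <= q)%N -> coprime p q -> crystallographic q -> p = 1%N.
Proof.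
move=> p0 pq cpq; rewrite /crystallographic !inE => h.
have : (p < 4)%N by move: h; lia.
case: p p0 pq cpq => [|[|[|[|]]]] // _.
  by case/or4P: h => [/eqP->|/eqP->|/eqP->|/orP[]/eqP->].
by case/or4P: h => [/eqP->|/eqP->|/eqP->|/orP[]/eqP->].
Qed.

(** In the excluded cases r^2 is 2, 3, 3/2 or 4/3 up to inversion, and a
    rational multiple of r would be a square root of 2, 3 or 6. *)
Lemma versine_ratio_nonsquare (q1 q2 : nat) (r : rat) :
  (1 < q1)%N -> (1 < q2)%N -> crystallographic q1 -> crystallographic q2 ->
  versine q1 = r ^+ 2 * versine q2 ->
  [\/ q1 = q2, q1 = 2 /\ q2 = 6 | q1 = 6 /\ q2 = 2]%N.
Proof.
have nsq (t : rat) (n : nat) : n \in [:: 2; 3; 6]%N -> t ^+ 2 <> n%:R.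
  move=> nI /sqr_rat_nat[m nE]; have m3 : (m < 3)%N.
    by rewrite ltnNge; apply/negP => m3; move: nI; rewrite nE !inE; nia.
  by move: nI m3; rewrite nE; case: m {nE} => [|[|[|]]].
have {}nsq (a : rat) (n : nat) : n \in [:: 2; 3; 6]%N ->
    a * a * r ^+ 2 <> n%:R.
  by move=> nI; rewrite -expr2 -exprMn; exact: nsq.
move=> q1_gt1 q2_gt1.
rewrite /crystallographic !inE.
case/or4P => [/eqP q1E|/eqP->|/eqP->|/orP[]/eqP->];
  first by rewrite q1E in q1_gt1.
all: case/or4P => [/eqP q2E|/eqP->|/eqP->|/orP[]/eqP->];
  first by rewrite q2E in q2_gt1.
all: rewrite /versine /= => e; first [by constructor | exfalso].
- by apply: (nsq (3 / 2) 3%N) => //; lra.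
- by apply: (nsq 1 2%N) => //; lra.
- by apply: (nsq 2 3%N) => //; lra.
- by apply: (nsq 2 6%N) => //; lra.
- by apply: (nsq 1 3%N) => //; lra.
- by apply: (nsq 2 2%N) => //; lra.
- by apply: (nsq 3 6%N) => //; lra.
- by apply: (nsq 1 2%N) => //; lra.
- by apply: (nsq 3 3%N) => //; lra.
- by apply: (nsq 2 2%N) => //; lra.
Qed.

(** Either both denominators are crystallographic or none is, because a
    crystallographic one makes both sides rational. *)
Lemma commensurable_turns (R : realType) (q1 p1 q2 p2 : nat) (r : rat) :
  (0 < p1)%N -> (p1.*2 <= q1)%N -> coprime p1 q1 ->
  (0 < p2)%N -> (p2.*2 <= q2)%N -> coprime p2 q2 ->
  1 - cos_turn R q1 p1 = ratr (r ^+ 2) * (1 - cos_turn R q2 p2) ->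
  [\/ q1 = q2 /\ p1 = p2,
      [/\ p1 = 1, q1 = 2, p2 = 1 & q2 = 6]%N |
      [/\ p1 = 1, q1 = 6, p2 = 1 & q2 = 2]%N].
Proof.
move=> p1_gt0 p1q1 cpq1 p2_gt0 p2q2 cpq2 rel.
have q1_gt1 : (1 < q1)%N by lia.
have q2_gt1 : (1 < q2)%N by lia.
have q1_gt0 := ltnW q1_gt1; have q2_gt0 := ltnW q2_gt1.
have s_gt0 := versine_ratio_gt0 q1_gt1 q2_gt1 cpq1 cpq2 rel.
set s := r ^+ 2 in rel s_gt0.
have sR : ratr s != 0 :> R by rewrite fmorph_eq0 gt_eqF.
have rel' : 1 - cos_turn R q2 p2 = ratr s^-1 * (1 - cos_turn R q1 p1).
  by rewrite fmorphV rel mulKf.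
have cr12 : crystallographic q1 = crystallographic q2.
  apply/idP/idP => cr; last first.
    apply: (@crystallographic_of_rational R q1 p1 (s * versine q2)) => //.
    by rewrite rel (crystallographic_turn1 _ p2q2) // versineP // [RHS]rmorphM.
  apply: (@crystallographic_of_rational R q2 p2 (s^-1 * versine q1)) => //.
  by rewrite rel' (crystallographic_turn1 _ p1q1) // versineP // [RHS]rmorphM.
have [cr1|ncr1] := boolP (crystallographic q1).
  have cr2 : crystallographic q2 by rewrite -cr12.
  have p1E := crystallographic_turn1 p1_gt0 p1q1 cpq1 cr1.
  have p2E := crystallographic_turn1 p2_gt0 p2q2 cpq2 cr2.
  move: rel; rewrite p1E p2E !versineP // -rmorphM => /fmorph_inj.
  case/(versine_ratio_nonsquare q1_gt1 q2_gt1 cr1 cr2).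
  - by move=> ->; constructor 1.
  - by move=> [-> ->]; constructor 2; split.
  - by move=> [-> ->]; constructor 3; split.
constructor 1.
have ncr2 : ~~ crystallographic q2 by rewrite -cr12.
have d12 := dvdn_double_transfer q1_gt0 q2_gt0 cpq1 rel ncr1.
have d21 := dvdn_double_transfer q2_gt0 q1_gt0 cpq2 rel' ncr2.
have [e|[e|e]] : q1 = q2 \/ (q1 = q2.*2 \/ q2 = q1.*2).
- case/dvdnP: d12 => a e2; case/dvdnP: d21 => b e1.
  (* q1 and q2 divide each other's doubles, so q1 / q2 is 1/2, 1 or 2. *)
  have ab : (a * b = 4)%N.
    apply/eqP; rewrite -(eqn_pmul2r (_ : 0 < q1 * q2)%N) ?muln_gt0 ?q1_gt0 //.
    by rewrite mulnACA -e1 -e2 -!muln2 -mulnACA mulnC [(q2 * q1)%N]mulnC.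
  have a4 : (a < 5)%N by rewrite ltnS -ab; case: b ab {e1} => // b; lia.
  clear -q1_gt0 q2_gt0 e1 e2 ab a4.
  by case: a ab a4 e2 => [|[|[|[|[|]]]]] // *; lia.
- subst q2; split=> //.
  have v0 := turn_versine_gt0 R q1_gt1 (coprime1n q1).
  have := min_transfer_eq q1_gt1 q1_gt1 cpq1 cpq2 s_gt0 rel.
  rewrite -{1}[1 - _]mul1r => /(mulIf (lt0r_neq0 v0)) s1.
  move: rel; rewrite -s1 mul1r => /addrI/oppr_inj e.
  have := cos_turn_half_lt R p1q1 p2q2; have := cos_turn_half_lt R p2q2 p1q1.
  by rewrite e ltxx; lia.
- exfalso; move/negP: ncr1; apply; subst q1.
  exact: (double_turn_crystallographic q2_gt1 cpq1 cpq2 rel).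
exfalso; move/negP: ncr2; apply; subst q2.
exact: (double_turn_crystallographic q1_gt1 cpq2 cpq1 rel').
Qed.

(** * Broken rays wind around the circle by a constant angle *)

Lemma rV2P (R : realType) (u v : 'rV[R]_2) :
  u 0 0 = v 0 0 -> u 0 1 = v 0 1 -> u = v.
Proof.
move=> e0 e1; apply/rowP => j.
case: j => -[|[|//]] j2.
  by rewrite (_ : Ordinal j2 = 0) //; apply: val_inj.
by rewrite (_ : Ordinal j2 = 1) //; apply: val_inj.
Qed.

Lemma dotE (R : realType) (u v : 'rV[R]_2) :
  dot u v = u 0 0 * v 0 0 + u 0 1 * v 0 1.
Proof.
rewrite /dot big_ord_recl big_ord1; congr (_ * _ + u 0 _ * v 0 _);
by apply: val_inj.
Qed.

Lemma dot_ge0 (R : realType) (u : 'rV[R]_2) : 0 <= dot u u.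
Proof. by rewrite dotE -!expr2 addr_ge0 ?sqr_ge0. Qed.

Lemma enorm_sqr (R : realType) (u : 'rV[R]_2) : enorm u ^+ 2 = dot u u.
Proof. by rewrite sqr_sqrtr ?dot_ge0. Qed.

Lemma on_unit_circleE (R : realType) (u : 'rV[R]_2) :
  on_unit_circle u -> dot u u = 1.
Proof. by rewrite -enorm_sqr => ->; rewrite expr1n. Qed.

Lemma enorm_gt0 (R : realType) (u : 'rV[R]_2) : u <> 0 -> 0 < enorm u.
Proof.
move=> u0; rewrite lt0r sqrtr_ge0 andbT; apply/eqP => e; apply: u0.
have := enorm_sqr u; rewrite e expr0n /= dotE -!expr2 => /esym/eqP.
rewrite paddr_eq0 ?sqr_ge0 // !sqrf_eq0 => /andP[/eqP u0 /eqP u1].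
by apply: rV2P; rewrite mxE.
Qed.

Lemma circle_point_x (R : realType) (t : R) : circle_point t 0 0 = cos t.
Proof. by rewrite mxE. Qed.

Lemma circle_point_y (R : realType) (t : R) : circle_point t 0 1 = sin t.
Proof. by rewrite mxE. Qed.

Lemma dot_circle_point (R : realType) (s t : R) :
  dot (circle_point s) (circle_point t) = cos (s - t).
Proof. by rewrite dotE !circle_point_x !circle_point_y cosB. Qed.

Lemma rotate_circle_point (R : realType) (s t : R) :
  rotate s (circle_point t) = circle_point (s + t).
Proof.
by apply: rV2P; rewrite ?circle_point_x ?circle_point_y mxE /= !mxE /= ?cosD ?sinD; ring.
Qed.

Lemma dot_rotate (R : realType) (t : R) (u v : 'rV[R]_2) :
  dot (rotate t u) (rotate t v) = dot u v.
Proof.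
transitivity ((cos t ^+ 2 + sin t ^+ 2) * dot u v); last first.
  by rewrite cos2Dsin2 mul1r.
by rewrite !dotE !mxE /=; ring.
Qed.

Lemma rotateNK (R : realType) (t : R) (u : 'rV[R]_2) :
  rotate t (rotate (- t) u) = u.
Proof.
transitivity ((cos t ^+ 2 + sin t ^+ 2) *: u); last first.
  by rewrite cos2Dsin2 scale1r.
by apply: rV2P; rewrite !mxE /= ?mxE cosN sinN; ring.
Qed.

Lemma circle_point_surj (R : realType) (u : 'rV[R]_2) :
  on_unit_circle u ->
  exists (t : R) (b : bool), 0 <= t <= pi /\ u = circle_point ((-1) ^+ b * t).
Proof.
move=> /on_unit_circleE; rewrite dotE => u1.
have u0 : -1 <= u 0 0 <= 1 by apply/andP; split; nra.
have [tpi ct] := acos_def u0.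
exists (acos (u 0 0)), (u 0 1 < 0); split => //.
have s1 : sin (acos (u 0 0)) = `|u 0 1|.
  rewrite sin_acos // -sqrtr_sqr; congr Num.sqrt; move: u1; lra.
apply: rV2P; rewrite ?circle_point_x ?circle_point_y.
  by case: (_ < _); rewrite ?expr0 ?expr1 ?mul1r // mulN1r cosN ct.
have [n|p] := ltP (u 0 1) 0.
  by rewrite expr1 mulN1r sinN s1 ltr0_norm // opprK.
by rewrite expr0 mul1r s1 ger0_norm.
Qed.

Lemma circle_pointD (R : realType) (s t : R) :
  circle_point (s + t) =
  (2 * cos t) *: circle_point s - circle_point (s - t).
Proof.
by apply: rV2P; rewrite !mxE /= ?cosD ?sinD cosN sinN; ring.
Qed.

(** Let l and m be the lengths of the incoming and of the outgoing leg.  Then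
    <d, b> = l / 2, hence c = b + m w for the unit vector w = d - l b with
    <b, w> = - l / 2, and |c| = 1 yields m (m - l) = 0.  With m = l the
    reflection law becomes linear in a and b. *)
Lemma reflection_recurrence (R : realType) (a b c : 'rV[R]_2) :
  on_unit_circle a -> on_unit_circle b -> on_unit_circle c ->
  b <> a -> c <> b ->
  (let d := direction (b - a) in
   direction (c - b) = d - (2 * dot d b) *: b) ->
  c = (2 * dot b a) *: b - a.
Proof.
move=> /on_unit_circleE ua /on_unit_circleE ub /on_unit_circleE uc ba cb /=.
rewrite /direction.
have : 0 < enorm (b - a) by apply: enorm_gt0 => /eqP; rewrite subr_eq0 => /eqP.
have : 0 < enorm (c - b) by apply: enorm_gt0 => /eqP; rewrite subr_eq0 => /eqP.
have := enorm_sqr (b - a).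
move: (enorm (c - b)) (enorm (b - a)) => m l l2 m_gt0 l_gt0 e.
have {}l2 : l ^+ 2 = 2 - 2 * dot b a.
  by rewrite l2; move: ua ub; rewrite !dotE !mxE; lra.
have D : dot (l^-1 *: (b - a)) b = l / 2.
  apply: (mulfI (lt0r_neq0 l_gt0)); rewrite -[RHS]/(l * (l / 2)) mulrA -expr2 l2.
  have -> : l * dot (l^-1 *: (b - a)) b = dot (b - a) b.
    by rewrite !dotE !mxE; field; exact: lt0r_neq0.
  by move: ub; rewrite !dotE !mxE; lra.
rewrite D in e.
have cE j : c 0 j = b 0 j + m * ((b 0 j - a 0 j) / l - l * b 0 j).
  have := congr1 (fun v : 'rV[R]_2 => v 0 j) e; rewrite !mxE => ej.
  have -> : c 0 j = b 0 j + m * (m^-1 * (c 0 j - b 0 j)).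
    by field; exact: lt0r_neq0.
  by rewrite ej; field; exact: lt0r_neq0.
have ml : m = l.
  have : m * (m - l) = 0.
    have -> : m * (m - l) = dot c c - 1.
      pose x j := (b 0 j - a 0 j) / l.
      have xb : x 0 * b 0 0 + x 1 * b 0 1 = l / 2.
        by rewrite -D dotE !mxE /x; ring.
      have xx : x 0 ^+ 2 + x 1 ^+ 2 = 1.
        rewrite /x !expr_div_n -mulrDl.
        have -> : (b 0 0 - a 0 0) ^+ 2 + (b 0 1 - a 0 1) ^+ 2 = l ^+ 2.
          by rewrite l2; move: ua ub; rewrite !dotE => *; lra.
        by rewrite divff // expf_neq0 // lt0r_neq0.
      move: ub; rewrite !dotE !cE -/(x 0) -/(x 1) => ub.
      have -> : (b 0 0 + m * (x 0 - l * b 0 0)) * (b 0 0 + m * (x 0 - l * b 0 0)) +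
          (b 0 1 + m * (x 1 - l * b 0 1)) * (b 0 1 + m * (x 1 - l * b 0 1)) =
          (1 - m * l) ^+ 2 * (b 0 0 * b 0 0 + b 0 1 * b 0 1)
          + 2 * m * (1 - m * l) * (x 0 * b 0 0 + x 1 * b 0 1)
          + m ^+ 2 * (x 0 ^+ 2 + x 1 ^+ 2) by ring.
      by rewrite ub xb xx; field.
    by rewrite uc subrr.
  by move/eqP; rewrite mulf_eq0 gt_eqF //= subr_eq0 => /eqP.
have {}cE j : c 0 j = 2 * dot b a * b 0 j - a 0 j.
  rewrite cE ml.
  have -> : 2 * dot b a = 2 - l ^+ 2 by rewrite l2; ring.
  by field; exact: lt0r_neq0.
by apply: rV2P; rewrite !mxE cE.
Qed.

(** The vertices advance by the angle d, which is not reduced modulo 2 pi; its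
    sign is the orientation. *)
Definition winding (R : realType) (d t : R) (x : polygonal_path R) : Prop :=
  forall k : int, x k = circle_point (t + k%:~R * d).

Lemma broken_ray_recurrence (R : realType) (x : polygonal_path R) (k : int) :
  broken_ray x ->
  x (k + 1) = (2 * dot (x k) (x (k - 1))) *: x k - x (k - 1).
Proof.
move=> bx; have [uk kn rk] := bx k; have [uk1 kn1 _] := bx (k - 1).
have [ukS _ _] := bx (k + 1).
apply: reflection_recurrence => //; first by move: kn1; rewrite subrK.
by move: rk; rewrite /reflects_at /leg subrK.
Qed.

(** Two consecutive vertices determine the path in both directions: read
    forwards, the recurrence shows that <x k, x (k + 1)> equals
    <x k, x (k - 1)>, so it can also be solved for x (k - 1), and
    [circle_pointD] is the same recurrence for points at constant angular
    distance. *)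
Lemma broken_ray_winding (R : realType) (x : polygonal_path R) :
  broken_ray x ->
  exists (t d : R) (b : bool), [/\ 0 < d, d <= pi & winding ((-1) ^+ b * d) t x].
Proof.
move=> bx; have [u0 x10 _] := bx 0; have [u1 _ _] := bx 1.
have [t0 [b0 [_ x0E]]] := circle_point_surj u0.
set t := _ * t0 in x0E.
have ur : on_unit_circle (rotate (- t) (x 1)).
  by rewrite /on_unit_circle /enorm dot_rotate; exact: u1.
have [d [b [/andP[d0 dpi] x1E]]] := circle_point_surj ur.
exists t, d, b; set e := _ * d in x1E *.
have {}x1E : x 1 = circle_point (t + e).
  by rewrite -rotate_circle_point -x1E rotateNK.
have H k : x k = circle_point (t + k%:~R * e) /\
           x (k + 1) = circle_point (t + (k + 1)%:~R * e).
  elim/int_ind: k => [|n [IH IHS]|n [IH IHS]].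
  - by rewrite add0r mul0r addr0 mul1r.
  - rewrite intS [1 + _]addrC; split=> //.
    rewrite broken_ray_recurrence // addrK IH IHS dot_circle_point.
    have shift (j : int) : t + (j + 1)%:~R * e = t + j%:~R * e + e.
      by rewrite intrD; ring.
    rewrite [in RHS]shift [RHS]circle_pointD.
    by congr ((2 * cos _) *: _ - circle_point _); rewrite shift; ring.
  - rewrite intS opprD [- 1 - _]addrC; rewrite subrK; split=> //.
    have := broken_ray_recurrence (- n%:Z) bx.
    have : dot (x (- n%:Z)) (x (- n%:Z + 1)) = dot (x (- n%:Z)) (x (- n%:Z - 1)).
      have [/on_unit_circleE un _ _] := bx (- n%:Z).
      rewrite broken_ray_recurrence //.
      move: (x (- n%:Z)) (x (- n%:Z - 1)) un => v w; rewrite !dotE !mxE => un.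
      transitivity (2 * (v 0 0 * w 0 0 + v 0 1 * w 0 1) *
          (v 0 0 * v 0 0 + v 0 1 * v 0 1) - (v 0 0 * w 0 0 + v 0 1 * w 0 1)).
        by ring.
      by rewrite un; ring.
    move=> <-; rewrite IH IHS dot_circle_point.
    have -> : t + (- n%:Z + 1)%:~R * e = t + (- n%:Z)%:~R * e + e.
      by rewrite intrD; ring.
    set s := t + _ * e; rewrite opprD addrA subrr sub0r cosN circle_pointD => h.
    have -> : t + (- n%:Z - 1)%:~R * e = s - e by rewrite /s intrB; ring.
    by move/addrI/oppr_inj: h => ->.
split; [|exact: dpi|by move=> k; have [] := H k].
rewrite lt_def d0 andbT; apply/eqP => d00; apply: x10.
by rewrite add0r x1E x0E /e d00 mulr0 addr0.
Qed.

Lemma cos_eq1_2pi (R : realType) (y : R) :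
  0 <= y -> cos y = 1 -> exists j : nat, y = 2 * pi * j%:R.
Proof.
move=> y0 cy; have pi0 : 0 < 2 * pi :> R by rewrite mulr_gt0 ?pi_gt0.
exists (Num.truncn (y / (2 * pi))); set j := Num.truncn _.
have /andP[jl ju] : j%:R <= y / (2 * pi) < j.+1%:R.
  by apply: truncn_itv; rewrite divr_ge0 // ltW.
set z := y - 2 * pi * j%:R.
have z0 : 0 <= z by rewrite subr_ge0 mulrC -ler_pdivlMr.
have z2 : z < 2 * pi.
  rewrite /z ltrBlDr -{1}[2 * pi]mulr1 -mulrDr -(natrD _ 1 j) add1n.
  by rewrite mulrC -ltr_pdivrMr.
have cz : cos z = 1 by rewrite -(@cos_sinD2pi R z j) /z subrK.
have s0 : sin (z / 2) = 0.
  have zz : (z / 2) *+ 2 = z by rewrite -mulr_natr divfK.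
  have := cos_mulr2n (z / 2); rewrite zz cz cos2sin2 => e.
  by apply/eqP; rewrite -sqrf_eq0; move: e; rewrite -mulr_natr => e; apply/eqP; lra.
have [zp|] := ltP 0 z.
  have : 0 < sin (z / 2) by apply: sin_gt0_pi; apply/andP; split; lra.
  by rewrite s0 ltxx.
by move=> zn; apply/eqP; rewrite -subr_eq0 -/z eq_le zn z0.
Qed.

(** The vertex sequences that describe a [regular_ray] with either
    orientation; see [regularP]. *)
Definition regular (R : realType) (p q : nat) (x : polygonal_path R) : Prop :=
  exists (t : R) (b : bool), winding ((-1) ^+ b * (2 * pi * p%:R / q%:R)) t x.

Lemma regularP (R : realType) (p q : nat) (x : polygonal_path R) :
  (exists t : R, same_ray (regular_ray p q t) x) <-> regular p q x.
Proof.
split=> [[t [m [xE|xE]]]|[t [[] xE]]].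
- exists (t + m%:~R * (2 * pi * p%:R / q%:R)), false => k.
  by rewrite xE /regular_ray intrD; congr circle_point; ring.
- exists (t + m%:~R * (2 * pi * p%:R / q%:R)), true => k.
  by rewrite xE /regular_ray intrB; congr circle_point; ring.
- exists t, 0; right=> k; rewrite xE /regular_ray intrB; congr circle_point; ring.
- by exists t, 0; left=> k; rewrite xE /regular_ray add0r expr0 mul1r.
Qed.

Lemma cos_signM (R : realType) (b : bool) (d : R) : cos ((-1) ^+ b * d) = cos d.
Proof. by rewrite mulr_sign; case: b; rewrite ?cosN. Qed.

Lemma winding_period (R : realType) (t d : R) (b : bool) (n : nat)
    (x : polygonal_path R) :
  winding ((-1) ^+ b * d) t x -> x n%:Z = x 0 -> cos (n%:R * d) = 1.
Proof.
move=> xE /(congr1 (dot (x 0))); rewrite !xE !dot_circle_point subrr cos0 mul0r.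
rewrite addr0 opprD addrA subrr sub0r cosN -pmulrn => e.
by rewrite -[RHS]e mulrCA cos_signM.
Qed.

Lemma periodic_regular (R : realType) (x : polygonal_path R) :
  periodic_broken_ray x ->
  exists p q : nat, [/\ (0 < p)%N, (p.*2 <= q)%N, coprime p q & regular p q x].
Proof.
move=> [/broken_ray_winding[t [d [b [d_gt0 dpi xE]]]] [n [n_gt0 xn]]].
have nR : 0 < n%:R :> R by rewrite ltr0n.
have := xn 0; rewrite add0r => /(winding_period xE)/cos_eq1_2pi[].
  by rewrite mulr_ge0 // ltW.
move=> j jE; have pi2 : 0 < 2 * pi :> R by rewrite mulr_gt0 ?pi_gt0.
have j_gt0 : (0 < j)%N.
  by rewrite -(ltr0n R) -(pmulr_rgt0 _ pi2) -jE mulr_gt0.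
have jn : (j.*2 <= n)%N.
  have : 2 * pi * j%:R <= n%:R * pi :> R by rewrite -jE ler_wpM2l // ltW.
  have -> : 2 * pi * j%:R = j.*2%:R * pi :> R by rewrite -muln2 natrM; ring.
  by rewrite ler_pM2r ?pi_gt0 // ler_nat.
pose g := gcdn j n.
have g_gt0 : (0 < g)%N by rewrite gcdn_gt0 j_gt0.
have [p jp] := dvdnP (dvdn_gcdl j n); have [q nq] := dvdnP (dvdn_gcdr j n).
rewrite -/g in jp nq.
exists p, q; split.
- by move: j_gt0; rewrite jp muln_gt0 => /andP[].
- by move: jn; rewrite jp nq -!muln2 mulnAC leq_pmul2r.
- by rewrite /coprime -(eqn_pmul2r g_gt0) muln_gcdl -jp -nq mul1n.
exists t, b => k; rewrite xE; congr (circle_point (_ + _ * (_ * _))).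
apply: (mulfI (lt0r_neq0 nR)); rewrite jE jp nq !natrM.
field; rewrite pnatr_eq0 -lt0n; by move: n_gt0; rewrite nq muln_gt0 => /andP[].
Qed.

(** A period m satisfies cos (2 pi p m / q) = 1, so q divides p m. *)
Lemma regular_primitive_period (R : realType) (p q : nat) (x : polygonal_path R) :
  (0 < q)%N -> coprime p q -> regular p q x -> primitive_period x = q.
Proof.
move=> q_gt0 pq [t [b xE]].
have per m : is_period x m -> (q %| m)%N.
  move=> [_ xm]; have := xm 0; rewrite add0r => /(winding_period xE) h.
  rewrite -(@Gauss_dvdr _ p) 1?coprime_sym //; apply: (@cos_turn_eq1 R) => //.
  rewrite -h /cos_turn natrM; congr cos; field.
  by rewrite pnatr_eq0 -lt0n.
have perq : is_period x q.
  split=> // k; rewrite !xE intrD.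
  have e (s : R) (j : nat) : circle_point (s + 2 * pi * j%:R) = circle_point s.
    by apply: rV2P; rewrite ?circle_point_x ?circle_point_y cos_sinD2pi.
  have q0 : q%:R != 0 :> R by rewrite pnatr_eq0 -lt0n.
  case: b {xE} => /=; rewrite ?expr0 ?expr1.
    rewrite -[LHS](e _ p); congr circle_point; rewrite -pmulrn; field.
    exact: q0.
  rewrite -[RHS](e _ p); congr circle_point; rewrite -pmulrn; field.
  exact: q0.
have pq1 : is_primitive_period x q.
  split=> // m pm; apply: dvdn_leq (per _ pm); by case: pm.
rewrite /primitive_period; case: xgetP => [n _ [pn nmin]|/(_ q)]; last by [].
apply/eqP; rewrite eqn_leq nmin // dvdn_leq ?per //; by case: pn.
Qed.

Lemma regular_length (R : realType) (p q : nat) (x : polygonal_path R) :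
  (0 < q)%N -> coprime p q -> regular p q x ->
  ray_length x = q%:R * Num.sqrt (2 * (1 - cos_turn R q p)).
Proof.
move=> q_gt0 pq xr; rewrite /ray_length (regular_primitive_period q_gt0 pq xr).
have [t [b xE]] := xr.
transitivity (\sum_(k < q) Num.sqrt (2 * (1 - cos_turn R q p))).
  apply: eq_bigr => k _; rewrite /enorm; congr Num.sqrt.
  rewrite /leg !xE; set s := t + k%:~R * _.
  have -> : t + (k%:Z + 1)%:~R * ((-1) ^+ b * (2 * pi * p%:R / q%:R)) =
      s + (-1) ^+ b * (2 * pi * p%:R / q%:R).
    by rewrite /s intrD; ring.
  set d := _ * (_ / _).
  have <- : cos d = cos_turn R q p.
    by rewrite cos_signM.
  have e : dot (circle_point (s + d)) (circle_point s) = cos d.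
    by rewrite dot_circle_point addrAC subrr add0r.
  transitivity (dot (circle_point (s + d)) (circle_point (s + d)) +
      dot (circle_point s) (circle_point s) -
      2 * dot (circle_point (s + d)) (circle_point s)).
    by rewrite !dotE !mxE /=; ring.
  by rewrite e !dot_circle_point !subrr cos0; ring.
by rewrite sumr_const card_ord [RHS]mulr_natl.
Qed.

Lemma regular_rotations (R : realType) (p q : nat) (x y : polygonal_path R) :
  regular p q x -> regular p q y -> rotations_of_each_other x y.
Proof.
move=> [t [b xE]] [u [c yE]]; exists (u - t), 0.
have sgn : (-1) ^+ c = (-1) ^+ (b (+) c) * (-1) ^+ b :> R.
  by case: b {xE} => /=; case: c {yE} => /=; rewrite ?expr0 ?expr1; ring.
case: (b (+) c) sgn => sgn; [right|left] => k; rewrite yE xE rotate_circle_point.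
  by rewrite sgn sub0r mulrNz ?intrN; congr circle_point; ring.
by rewrite sgn add0r; congr circle_point; ring.
Qed.

Lemma hexagon_length (R : realType) (x : polygonal_path R) :
  hexagon x -> ray_length x = 6.
Proof.
move/regularP => xr; rewrite (regular_length _ _ xr) // versineP //.
rewrite -[versine 6]/(1 / 2%:R) fmorph_div rmorph1 rmorph_nat.
have -> : 2 * (1 / 2) = 1 :> R by field.
by rewrite sqrtr1 mulr1.
Qed.

Lemma diameter_length (R : realType) (x : polygonal_path R) :
  diameter x -> ray_length x = 4.
Proof.
move/regularP => xr; rewrite (regular_length _ _ xr) // versineP //.
rewrite -[versine 2]/(2%:R) rmorph_nat -expr2 sqrtr_sqr ger0_norm //.
by ring.
Qed.

(** * Comparing lengths *)

(** The square of the length is 2 q^2 (1 - cos (2 pi p / q)), so a rational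
    ratio r of lengths gives the relation of [commensurable_turns] for the square
    of the rational number r q2 / q1. *)
Lemma rational_length_ratio (R : realType) (x1 x2 : polygonal_path R) (r : rat) :
  periodic_broken_ray x1 -> periodic_broken_ray x2 ->
  ray_length x1 / ray_length x2 = ratr r ->
  rotations_of_each_other x1 x2 \/
  (hexagon x1 /\ diameter x2) \/ (hexagon x2 /\ diameter x1).
Proof.
move=> /periodic_regular[p1 [q1 [p1_gt0 p1q1 cpq1 xr1]]].
move=> /periodic_regular[p2 [q2 [p2_gt0 p2q2 cpq2 xr2]]].
have q1_gt1 : (1 < q1)%N by lia.
have q2_gt1 : (1 < q2)%N by lia.
have q1_gt0 := ltnW q1_gt1; have q2_gt0 := ltnW q2_gt1.
rewrite (regular_length q1_gt0 cpq1 xr1) (regular_length q2_gt0 cpq2 xr2).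
have v1 := turn_versine_gt0 R q1_gt1 cpq1; have v2 := turn_versine_gt0 R q2_gt1 cpq2.
set c1 := Num.sqrt _; set c2 := Num.sqrt _ => e.
have c1E : c1 ^+ 2 = 2 * (1 - cos_turn R q1 p1).
  by rewrite sqr_sqrtr // mulr_ge0 // ltW.
have c2E : c2 ^+ 2 = 2 * (1 - cos_turn R q2 p2).
  by rewrite sqr_sqrtr // mulr_ge0 // ltW.
have c2_gt0 : 0 < c2 by rewrite sqrtr_gt0 mulr_gt0.
have q1R : q1%:R != 0 :> R by rewrite pnatr_eq0 -lt0n.
have q2R : q2%:R != 0 :> R by rewrite pnatr_eq0 -lt0n.
have rel : 1 - cos_turn R q1 p1 =
    ratr ((r * (q2%:R / q1%:R)) ^+ 2) * (1 - cos_turn R q2 p2).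
  have c12 : c1 = ratr r * (q2%:R / q1%:R) * c2.
    by rewrite -e; field; rewrite q1R q2R lt0r_neq0.
  rewrite rmorphXn rmorphM fmorph_div !rmorph_nat.
  apply: (mulfI (_ : 2 != 0 :> R)) => //.
  by rewrite -c1E mulrCA -c2E c12 exprMn.
case: (commensurable_turns p1_gt0 p1q1 cpq1 p2_gt0 p2q2 cpq2 rel).
- by move=> [qE pE]; left; rewrite -qE -pE in xr2; exact: regular_rotations xr1 xr2.
- move=> [p1E q1E p2E q2E]; right; right; rewrite p1E q1E in xr1; rewrite p2E q2E in xr2.
  by split; apply/regularP.
- move=> [p1E q1E p2E q2E]; right; left; rewrite p1E q1E in xr1; rewrite p2E q2E in xr2.
  by split; apply/regularP.
Qed.

Theorem theoremA3 (R : realType) :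
  (forall x1 x2 : polygonal_path R,
     periodic_broken_ray x1 -> periodic_broken_ray x2 ->
     basic x1 -> basic x2 ->
     ~ rotations_of_each_other x1 x2 ->
     ray_length x1 <> ray_length x2 /\
     ((exists r : rat, ray_length x1 / ray_length x2 = ratr r) <->
      (hexagon x1 /\ diameter x2) \/ (hexagon x2 /\ diameter x1))) /\
  (forall x : polygonal_path R, hexagon x -> ray_length x = 6) /\
  (forall x : polygonal_path R, diameter x -> ray_length x = 4).
Proof.
split; last by split=> x; [exact: hexagon_length | exact: diameter_length].
move=> x1 x2 px1 px2 _ _ nrot.
have fwd r : ray_length x1 / ray_length x2 = ratr r ->
    (hexagon x1 /\ diameter x2) \/ (hexagon x2 /\ diameter x1).
  by case/(rational_length_ratio px1 px2).
have len x y : hexagon x -> diameter y -> ray_length x = 6 /\ ray_length y = 4.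
  by move=> /hexagon_length-> /diameter_length->.
split.
  move=> e.
  have : (hexagon x1 /\ diameter x2) \/ (hexagon x2 /\ diameter x1).
    have [z|nz] := eqVneq (ray_length x2) 0.
      by apply: (fwd 0); rewrite z invr0 mulr0 rmorph0.
    by apply: (fwd 1); rewrite e divff // rmorph1.
  by move: e => /[swap] -[] [/len h /h[-> ->]] /eqP; rewrite eqr_nat.
split=> [[r /fwd//]|[] [/len h /h[-> ->]]].
  by exists (6%:R / 4%:R); rewrite fmorph_div !rmorph_nat.
by exists (4%:R / 6%:R); rewrite fmorph_div !rmorph_nat.
Qed.
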